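(* Let $k$ be a nonzero integer. Let $S_k=\{(X,Y)\in\mathbb{Z}^2 : Y^2=X^3+k\}$, and let $T_k$ be the set of triples $(F,x_0,y_0)$ where $F(x,y)=ax^3+3bx^2y+3cxy^2+dy^3$ with $a,b,c,d\in\mathbb{Z}$ is a binary cubic form of discriminant $D_F=-108k$ and $x_0,y_0$ are integers with $F(x_0,y_0)=1$. Then the map $$(F,x_0,y_0)\longmapsto (X,Y)=\left(H_1(x_0,y_0),\ \tfrac{1}{2}G_1(x_0,y_0)\right)$$ (where $H_1$ and $G_1$ are the covariants of $F$ defined in the context) induces a bijection between the set of $SL_2(\mathbb{Z})$-equivalence classes of triples in $T_k$ and the set $S_k$.
   Context: For a form $F(x,y)=ax^3+3bx^2y+3cxy^2+dy^3$ with $a,b,c,d\in\mathbb{Z}$, the discriminant is $D_F=-27(a^2d^2-6abcd-3b^2c^2+4ac^3+4b^3d)$. The forms need not be irreducible. The (normalized) covariants of $F$ are $$H_1(x,y)=(b^2-ac)x^2+(bc-ad)xy+(c^2-bd)y^2,$$ $$G_1(x,y)=a_1x^3+3b_1x^2y+3c_1xy^2+d_1y^3,$$ with $a_1=-a^2d+3abc-2b^3$, $b_1=-b^2c-abd+2ac^2$, $c_1=bc^2-2b^2d+acd$, $d_1=-3bcd+2c^3+ad^2$. For $\gamma=\begin{pmatrix}p&q\\ r&s\end{pmatrix}\in SL_2(\mathbb{Z})$, $(F\circ\gamma)(x,y)=F(px+qy,\,rx+sy)$; forms of the shape $ax^3+3bx^2y+3cxy^2+dy^3$ with $a,b,c,d\in\mathbb{Z}$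 are preserved by this action. Two triples $(F,x_0,y_0)$ and $(F',x_0',y_0')$ in $T_k$ are $SL_2(\mathbb{Z})$-equivalent if there is $\gamma\in SL_2(\mathbb{Z})$ with $F'=F\circ\gamma$ and $(x_0',y_0')^{T}=\gamma^{-1}(x_0,y_0)^{T}$. *)

(* Defs.v *)
From mathcomp Require Import all_boot all_order all_algebra.
From mathcomp Require Import classical_sets functions.

Set Implicit Arguments.
Unset Strict Implicit.
Unset Printing Implicit Defensive.

Import GRing.Theory.
Local Open Scope ring_scope.
Local Open Scope classical_set_scope.

(* Form a b c d stands for the form a x^3 + 3b x^2 y + 3c x y^2 + d y^3. *)
Record cubic_form := Form { ca : int; cb : int; cc : int; cd : int }.

Definition cubic_eval (F : cubic_form) (x y : int) : int :=
  let: Form a b c d := F in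
  a * x ^+ 3 + 3 * b * x ^+ 2 * y + 3 * c * x * y ^+ 2 + d * y ^+ 3.

Definition cubic_disc (F : cubic_form) : int :=
  let: Form a b c d := F in
  - 27 * (a ^+ 2 * d ^+ 2 - 6 * a * b * c * d - 3 * b ^+ 2 * c ^+ 2
          + 4 * a * c ^+ 3 + 4 * b ^+ 3 * d).

Definition covariant_H (F : cubic_form) (x y : int) : int :=
  let: Form a b c d := F in
  (b ^+ 2 - a * c) * x ^+ 2 + (b * c - a * d) * x * y
  + (c ^+ 2 - b * d) * y ^+ 2.

Definition covariant_G_form (F : cubic_form) : cubic_form :=
  let: Form a b c d := F in
  Form (- a ^+ 2 * d + 3 * a * b * c - 2 * b ^+ 3)
       (- b ^+ 2 * c - a * b * d + 2 * a * c ^+ 2)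
       (b * c ^+ 2 - 2 * b ^+ 2 * d + a * c * d)
       (- 3 * b * c * d + 2 * c ^+ 3 + a * d ^+ 2).

Definition covariant_G (F : cubic_form) (x y : int) : int :=
  cubic_eval (covariant_G_form F) x y.

(* F' = F o g, as polynomial functions on Z^2; since Z is infinite, this
   determines the coefficients of F'. *)
Definition is_cubic_comp (F : cubic_form) (g : 'M[int]_2) (F' : cubic_form)
    : Prop :=
  forall x y : int,
    cubic_eval F' x y
    = cubic_eval F (g 0 0 * x + g 0 1 * y) (g 1 0 * x + g 1 1 * y).

Definition triple : Type := (cubic_form * int * int)%type.

Definition col2 (x y : int) : 'cV[int]_2 :=
  \col_i (if i == 0 then x else y).

Definition SL2Z_equiv (t t' : triple) : Prop :=
  let: (F, x0, y0) := t in
  let: (F', x0', y0') := t' in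
  exists g : 'M[int]_2,
    [/\ \det g = 1,
        is_cubic_comp F g F'
      & col2 x0' y0' = invmx g *m col2 x0 y0].

Definition T_set (k : int) : set triple :=
  [set t | let: (F, x0, y0) := t in
           cubic_disc F = - 108 * k /\ cubic_eval F x0 y0 = 1].

Definition T_class (k : int) (t : triple) : set triple :=
  [set t' | T_set k t' /\ SL2Z_equiv t t'].

Definition T_classes (k : int) : set (set triple) :=
  [set T_class k t | t in T_set k].

Definition S_set (k : int) : set (int * int) :=
  [set P | P.2 ^+ 2 = P.1 ^+ 3 + k].

(* Rational-valued because of the factor 1/2: that the values are integral on
   T_set is part of what is to be proved. *)
Definition covariant_map (t : triple) : rat * rat :=
  let: (F, x0, y0) := t in
  ((covariant_H F x0 y0)%:~R, 2^-1 * (covariant_G F x0 y0)%:~R).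

(* Main.v *)
Require Import Defs.
From mathcomp Require Import all_boot all_order all_algebra.
From mathcomp Require Import classical_sets functions.
From mathcomp Require Import ring lra.

Import GRing.Theory.
Local Open Scope ring_scope.
Local Open Scope classical_set_scope.

(** The point of the proof is that every equivalence class in [T_set k]
    contains exactly one triple of the shape
    [(x^3 - 3 X x y^2 - 2 Y y^3, 1, 0)], and that the covariants read off
    [(X, Y)] from it.

    Existence.  If [F x0 y0 = 1], then by Euler's identity the integral matrix
    with columns [(x0, y0)] and [(- F_y / 3, F_x / 3)], the partial derivatives
    being taken at [(x0, y0)], has determinant [F x0 y0 = 1].  Its second column
    is tangent to [F] at [(x0, y0)], so composing [F] with it kills the
    coefficient of [x^2 y]; the remaining coefficients are [- 3 H] and [- G]
    (lemma [tangent_comp]).  The syzygy [G^2 = 4 H^3 + Delta F^2], where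
    [Delta = - D_F / 27 = 4 k], makes [G] even and puts [(H, G / 2)] on the curve
    (lemmas [syzygy] and [covariant_G_even]).

    Uniqueness.  An equivalence between two such triples fixes [(1, 0)], hence is
    a transvection [(x, y) |-> (x + q y, y)]; it creates the coefficient [3 q] in
    front of [x^2 y], so [q = 0] (lemma [reduced_triple_inj]).

    Consequently two triples of [T_set k] are equivalent exactly when they have
    the same covariant point (lemma [SL2Z_equiv_covariant_point]).  So the map is
    well defined on classes and injective, without any computation of how the
    covariants transform under [SL2], and the reduced triples give
    surjectivity. *)

(** * Equivalence of triples in coordinates *)

Lemma cubic_eval_inj (F F' : cubic_form) :
  (forall x y, cubic_eval F x y = cubic_eval F' x y) -> F = F'.
Proof.
case: F F' => [a b c d] [a' b' c' d'] /= eqF.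
have := (eqF 1 0, eqF 0 1, eqF 1 1, eqF 1 (-1)).
rewrite !expr1n !expr0n /= => -[[[e10 e01] e11] e1N].
have ea : a = a' by lra.
have ed : d = d' by lra.
have eb : b = b' by lra.
have ec : c = c' by lra.
by rewrite ea eb ec ed.
Qed.

Lemma mul_col2 (g : 'M[int]_2) (x y : int) :
  g *m col2 x y = col2 (g 0 0 * x + g 0 1 * y) (g 1 0 * x + g 1 1 * y).
Proof.
apply/colP => i; rewrite !mxE big_ord_recl big_ord1 !mxE /=.
have -> : lift ord0 ord0 = 1 :> 'I_2 by apply/val_inj.
by case: (eqVneq i 0) => [->//|]; case: i => [[|[|//]] lt_i] // _;
  have -> : Ordinal lt_i = 1 by apply/val_inj.
Qed.

Lemma col2_inj (x y x' y' : int) :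
  col2 x y = col2 x' y' -> x = x' /\ y = y'.
Proof. by move=> /colP e; have := (e 0, e 1); rewrite !mxE /= => -[]. Qed.

Lemma det2 (g : 'M[int]_2) : \det g = g 0 0 * g 1 1 - g 0 1 * g 1 0.
Proof.
rewrite (expand_det_row _ 0) big_ord_recl big_ord1 /cofactor !det_mx11 !mxE.
have -> : lift ord0 ord0 = 1 :> 'I_2 by apply/val_inj.
have -> : lift 1 0 = 0 :> 'I_2 by apply/val_inj.
by rewrite /= expr0 expr1; ring.
Qed.

(** The transformation of the base point is recorded as
    [(x, y) = g (x', y')], which avoids inverse matrices. *)
Lemma SL2Z_equivP (F F' : cubic_form) (x y x' y' : int) :
  SL2Z_equiv (F, x, y) (F', x', y') <->
  exists p q r s : int,
    [/\ p * s - q * r = 1,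
        forall u v,
          cubic_eval F' u v = cubic_eval F (p * u + q * v) (r * u + s * v),
        x = p * x' + q * y'
      & y = r * x' + s * y'].
Proof.
split=> [[g [det_g gF gxy]]|[p [q [r [s [det1 gF ex ey]]]]]].
  have g_unit : g \in unitmx by rewrite unitmxE det_g unitr1.
  exists (g 0 0), (g 0 1), (g 1 0), (g 1 1).
  have [ex ey] : x = g 0 0 * x' + g 0 1 * y' /\ y = g 1 0 * x' + g 1 1 * y'.
    by apply: col2_inj; rewrite -mul_col2 gxy mulKVmx.
  by split=> //; rewrite -det2.
pose g : 'M[int]_2 :=
  \matrix_(i, j) if i == 0 then if j == 0 then p else q
                 else if j == 0 then r else s.
have det_g : \det g = 1 by rewrite det2 !mxE.
have g_unit : g \in unitmx by rewrite unitmxE det_g unitr1.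
exists g; split=> //; first by move=> u v; rewrite !mxE.
by rewrite -[LHS](mulKmx g_unit) mul_col2 !mxE ex ey.
Qed.

Lemma SL2Z_equiv_sym (t t' : triple) : SL2Z_equiv t t' -> SL2Z_equiv t' t.
Proof.
case: t t' => [[F x] y] [[F' x'] y'].
move=> /SL2Z_equivP[p [q [r [s [det1 eF -> ->]]]]].
apply/SL2Z_equivP; exists s, (- q), (- r), p; split.
- by rewrite -det1; ring.
- move=> u v; rewrite eF.
  have -> : p * (s * u + - q * v) + q * (- r * u + p * v) = u.
    by rewrite -[RHS]mul1r -det1; ring.
  have -> // : r * (s * u + - q * v) + s * (- r * u + p * v) = v.
  by rewrite -[RHS]mul1r -det1; ring.
- by rewrite -[LHS]mul1r -det1; ring.
- by rewrite -[LHS]mul1r -det1; ring.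
Qed.

Lemma SL2Z_equiv_trans (t1 t2 t3 : triple) :
  SL2Z_equiv t1 t2 -> SL2Z_equiv t2 t3 -> SL2Z_equiv t1 t3.
Proof.
case: t1 t2 t3 => [[F1 x1] y1] [[F2 x2] y2] [[F3 x3] y3].
move=> /SL2Z_equivP[p [q [r [s [det1 eF -> ->]]]]].
move=> /SL2Z_equivP[p' [q' [r' [s' [det1' eF' -> ->]]]]].
apply/SL2Z_equivP.
exists (p * p' + q * r'), (p * q' + q * s').
exists (r * p' + s * r'), (r * q' + s * s'); split.
- by rewrite -[RHS]mulr1 -{1}det1 -det1'; ring.
- by move=> u v; rewrite eF' eF; congr cubic_eval; ring.
- by ring.
- by ring.
Qed.

(** * The covariant point of a triple *)

(** Euclidean division by 2 is exact on [T_set k], see [covariant_G_even]. *)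
Definition covariant_point (t : triple) : int * int :=
  let: (F, x0, y0) := t in
  (covariant_H F x0 y0, (covariant_G F x0 y0 %/ 2)%Z).

(** The classical syzygy [G^2 = 4 H^3 + Delta F^2], multiplied by 27 because the
    discriminant is [- 27 Delta]. *)
Lemma syzygy (F : cubic_form) (x y : int) :
  27 * covariant_G F x y ^+ 2 =
  108 * covariant_H F x y ^+ 3 - cubic_disc F * cubic_eval F x y ^+ 2.
Proof. by case: F => a b c d; rewrite /covariant_G /=; ring. Qed.

Lemma sqr_covariant_G (k : int) (F : cubic_form) (x y : int) :
  T_set k (F, x, y) ->
  covariant_G F x y ^+ 2 = 4 * (covariant_H F x y ^+ 3 + k).
Proof. by move=> [disc F1]; have := syzygy F x y; rewrite disc F1; lra. Qed.

Lemma covariant_G_even (k : int) (F : cubic_form) (x y : int) :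
  T_set k (F, x, y) ->
  covariant_G F x y = 2 * (covariant_point (F, x, y)).2.
Proof.
move=> /sqr_covariant_G sqrG; rewrite /= mulrC divzK //.
have : (2 %| covariant_G F x y ^+ 2)%Z by rewrite sqrG !dvdz_mulr.
by rewrite !dvdzE abszX Euclid_dvdX // => /andP[].
Qed.

Lemma covariant_mapE (k : int) (t : triple) : T_set k t ->
  ((covariant_point t).1%:~R, (covariant_point t).2%:~R) = covariant_map t.
Proof.
case: t => [[F x] y] Tt; rewrite /covariant_map (covariant_G_even _ _ _ _ Tt).
by rewrite rmorphM mulKf.
Qed.

Lemma covariant_point_S (k : int) (t : triple) :
  T_set k t -> S_set k (covariant_point t).
Proof.
case: t => [[F x] y] Tt; have := sqr_covariant_G _ _ _ _ Tt.
by rewrite (covariant_G_even _ _ _ _ Tt) /S_set /= exprMn; lra.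
Qed.

(** * Reduced triples *)

Definition reduced_triple (P : int * int) : triple :=
  (Form 1 0 (- P.1) (- (2 * P.2)), 1, 0).

Lemma reduced_triple_T (k : int) (P : int * int) :
  S_set k P -> T_set k (reduced_triple P).
Proof.
case: P => X Y; rewrite /S_set /= => eY; split; last by ring.
have -> : k = Y ^+ 2 - X ^+ 3 by rewrite eY; ring.
by ring.
Qed.

Lemma covariant_point_reduced (P : int * int) :
  covariant_point (reduced_triple P) = P.
Proof.
case: P => X Y; rewrite /covariant_point /reduced_triple /covariant_G /=.
congr pair; first by ring.
by rewrite -[RHS](@mulzK _ 2) //; congr divz; ring.
Qed.

(** [F] in the basis formed by [(x, y)] and its tangent vector
    [(- F_y / 3, F_x / 3)]; the factor [F x y] is the determinant of this change
    of basis. *)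
Lemma tangent_comp (a b c d x y u v : int) :
  let F := Form a b c d in
  cubic_eval F
    (x * u - (b * x ^+ 2 + 2 * c * x * y + d * y ^+ 2) * v)
    (y * u + (a * x ^+ 2 + 2 * b * x * y + c * y ^+ 2) * v) =
  cubic_eval F x y *
  cubic_eval (Form 1 0 (- covariant_H F x y) (- covariant_G F x y)) u v.
Proof. by rewrite /covariant_G /=; ring. Qed.

Lemma SL2Z_equiv_reduced (k : int) (t : triple) : T_set k t ->
  SL2Z_equiv t (reduced_triple (covariant_point t)).
Proof.
case: t => [[F x] y] Tt; have [_ F1] := Tt.
rewrite /reduced_triple -(covariant_G_even _ _ _ _ Tt).
case: F F1 {Tt} => a b c d F1; apply/SL2Z_equivP.
exists x, (- (b * x ^+ 2 + 2 * c * x * y + d * y ^+ 2)).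
exists y, (a * x ^+ 2 + 2 * b * x * y + c * y ^+ 2); split.
- by rewrite -[RHS]F1 /=; ring.
- by move=> u v; rewrite mulNr tangent_comp F1 mul1r.
- by ring.
- by ring.
Qed.

(** The stabiliser of [(1, 0)] consists of the transvections, and only the
    trivial one preserves the vanishing of the coefficient of [x^2 y]. *)
Lemma reduced_triple_inj (P P' : int * int) :
  SL2Z_equiv (reduced_triple P) (reduced_triple P') -> P = P'.
Proof.
case: P P' => X Y [X' Y'] /SL2Z_equivP[p [q [r [s [det1 eF ep er]]]]].
have p1 : p = 1 by rewrite ep; ring.
have r0 : r = 0 by rewrite er; ring.
have s1 : s = 1 by rewrite -det1 p1 r0; ring.
have [q0 eX eY] : Form 1 0 (- X') (- (2 * Y')) =
    Form 1 q (q ^+ 2 - X) (q ^+ 3 - 3 * X * q - 2 * Y).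
  by apply: cubic_eval_inj => u v; rewrite eF p1 r0 s1 /=; ring.
by rewrite -q0 in eX eY; congr pair; lra.
Qed.

Lemma SL2Z_equiv_covariant_point (k : int) (t t' : triple) :
  T_set k t -> T_set k t' ->
  SL2Z_equiv t t' <-> covariant_point t = covariant_point t'.
Proof.
move=> /SL2Z_equiv_reduced red_t /SL2Z_equiv_reduced red_t'; split=> [tt'|eqP].
  apply: reduced_triple_inj.
  exact: SL2Z_equiv_trans (SL2Z_equiv_sym _ _ red_t)
           (SL2Z_equiv_trans _ _ _ tt' red_t').
by apply: SL2Z_equiv_trans red_t _; rewrite eqP; exact: SL2Z_equiv_sym.
Qed.

(** * The bijection *)

Lemma T_classE (k : int) (t : triple) : T_set k t ->
  T_class k t =
  [set t' | T_set k t' /\ covariant_point t = covariant_point t'].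
Proof.
move=> Tt; apply/seteqP; split=> t' [Tt' h]; split=> //;
  exact/(SL2Z_equiv_covariant_point k).
Qed.

(** All members of a class have the same covariant point, so the choice of a
    member is immaterial there. *)
Definition class_point (C : set triple) : int * int :=
  xget (0, 0) [set covariant_point t | t in C].

Lemma class_pointE (k : int) (t : triple) :
  T_set k t -> class_point (T_class k t) = covariant_point t.
Proof.
move=> Tt; rewrite /class_point T_classE //.
by case: xgetP => [_ _ [t' [_ ->] ->]//|/(_ (covariant_point t))[]]; exists t.
Qed.

Theorem mainTheorem1 (k : int) (k_neq0 : k != 0) :
  exists f : set triple -> int * int,
    set_bij (T_classes k) (S_set k) f
    /\ forall t : triple, T_set k t ->
         ((f (T_class k t)).1%:~R, (f (T_class k t)).2%:~R) = covariant_map t.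
Proof.
exists class_point; split; last first.
  by move=> t Tt; rewrite (class_pointE _ _ Tt) (covariant_mapE _ _ Tt).
split.
- by move=> _ [t Tt <-]; rewrite (class_pointE _ _ Tt); exact: covariant_point_S.
- move=> _ _ /set_mem[t Tt <-] /set_mem[t' Tt' <-].
  by rewrite !(class_pointE k) // !T_classE // => ->.
- move=> P /reduced_triple_T TP.
  exists (T_class k (reduced_triple P)); first by exists (reduced_triple P).
  by rewrite (class_pointE _ _ TP) covariant_point_reduced.
Qed.
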